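(* Let $n\ge 1$, $N=2^n$, $B_n=\{0,1\}^n$, and let $S_N$ denote the set of all bijections $B_n\to B_n$. For $\sigma\in S_n$ define $\sigma'\in S_N$ by $\sigma'(x_1,\dots,x_n)=(x_{\sigma(1)},\dots,x_{\sigma(n)})$. Call $F,H\in S_N$ equivalent if there exist $\rho,\sigma\in S_n$ with $H=\rho'\circ F\circ\sigma'$, and let $V_n$ be the number of equivalence classes. For a partition $p=(p_1,\dots,p_n)\in P_n$ (where $P_n=\{(p_1,\dots,p_n)\mid p_i\ge 0,\ \sum_i ip_i=n\}$), choose any $\sigma\in S_n$ with $\mathrm{spec}(\sigma)=p$ and let $\mathrm{spec}(\sigma')=(p'_1,\dots,p'_N)$. Then $$V_n=\sum_{p\in P_n}\frac{\prod_{i} i^{p'_i}\, p'_i!}{\Big(\prod_{i} i^{p_i}\, p_i!\Big)^2}.$$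
   Context: For a permutation $\sigma$ of an $r$-element set, $\mathrm{spec}(\sigma)=(p_1,\dots,p_r)$ where $p_i$ is the number of cycles of length $i$ in the cycle decomposition of $\sigma$ (fixed points counted as cycles of length $1$). The vector $\mathrm{spec}(\sigma')$ depends only on $\mathrm{spec}(\sigma)$, so $p'$ is determined by $p$. *)

(* Defs.v *)
From HB Require Import structures.
From mathcomp Require Import all_boot all_order all_algebra all_fingroup.

Set Implicit Arguments.
Unset Strict Implicit.
Unset Printing Implicit Defensive.

(* Cycles are indexed by their actual length i, so the cycle type vector
   of s is (spec s 1, ..., spec s r) with r = #|T|. *)
Definition spec (T : finType) (s : {perm T}) (i : nat) : nat :=
  #|[set C in porbits s | #|C| == i]|.

Definition cube (n : nat) : finType := {ffun 'I_n -> bool}.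

Definition coord_fun (n : nat) (s : 'S_n) (x : cube n) : cube n :=
  [ffun i => x (s i)].

Lemma coord_fun_inj (n : nat) (s : 'S_n) : injective (@coord_fun n s).
Proof.
move=> x y /ffunP exy; apply/ffunP => i.
by have := exy ((s^-1)%g i); rewrite !ffunE permKV.
Qed.

Definition coord_perm (n : nat) (s : 'S_n) : {perm cube n} :=
  perm (@coord_fun_inj n s).

(* Spelled out pointwise because the product of {perm _} composes from left to
   right. *)
Definition equivalent (n : nat) (F H : {perm cube n}) : bool :=
  [exists rho : 'S_n, exists sigma : 'S_n,
     [forall x, H x == coord_perm rho (F (coord_perm sigma x))]].

Definition nclasses (n : nat) : nat :=
  #|equivalence_partition (@equivalent n) [set: {perm cube n}]|.

(* The entry at index i : 'I_n is p_(i+1). Bounding the entries by n loses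
   nothing, since i * p_i <= n, and makes the ambient type finite. *)
Definition partitions (n : nat) : {set {ffun 'I_n -> 'I_n.+1}} :=
  [set p : {ffun 'I_n -> 'I_n.+1} | \sum_(i < n) i.+1 * p i == n].

(* Main.v *)
(** By Burnside's lemma for the action [(rho, sigma) : F |-> rho' F sigma'] of
    [S_n * S_n] on the permutations of the cube, [n!^2 V_n] is the number of
    triples [(rho, sigma, F)] such that [F] conjugates [sigma'] into [rho'].
    For a given pair the [F]s form a coset of the centralizer of [sigma'], or
    there are none, and a conjugating [F] exists exactly when [rho] and [sigma]
    have the same cycle type. Indeed, if [sigma'] and [rho'] are conjugate, all
    their powers have equally many fixed points, and [sigma'^k] has
    [2 ^ #cycles(sigma^k)] of them; since [sigma^k] has [\sum_C gcd(|C|, k)]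
    cycles, where [C] runs over the cycles of [sigma], Gauss's identity
    [gcd(m, k) = \sum_(d | m, d | k) phi(d)] lets one recover the number of
    cycles of length divisible by [d] for each [d], hence the cycle type.
    It remains to group the pairs by cycle type, using the order
    [\prod_i i^p_i p_i!] of the centralizer of a permutation of type [p]. *)
Require Import Defs.
From HB Require Import structures.
From mathcomp Require Import all_boot all_order all_algebra all_fingroup.
From mathcomp Require Import cyclic ring.

Set Implicit Arguments.
Unset Strict Implicit.
Unset Printing Implicit Defensive.

(** * Cycles of a permutation, and maps intertwining two permutations *)

Section CycleStructure.

Variable T : finType.
Implicit Types (s t F : {perm T}) (x y : T) (C : {set T}) (P : {set {set T}}).

Lemma permX_porbit_modn s x i : (s ^+ (i %% #|porbit s x|))%g x = (s ^+ i)%g x.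
Proof.
rewrite {2}(divn_eq i #|porbit s x|) addnC expgD permM mulnC expgM.
rewrite [in RHS]permX; set z := (s ^+ (i %% _))%g x.
have zE: (s ^+ #|porbit s x|)%g z = z.
  have -> : porbit s x = porbit s z by rewrite porbit_perm.
  by rewrite permX iter_porbit.
by elim: (i %/ _) => //= m <-.
Qed.

Lemma eq_permX_porbit s x i j :
  ((s ^+ i)%g x == (s ^+ j)%g x) = (i == j %[mod #|porbit s x|]).
Proof.
rewrite -(permX_porbit_modn s x i) -(permX_porbit_modn s x j).
have o_gt0: 0 < #|porbit s x| by rewrite lt0n card_porbit_neq0.
have lt_i := ltn_pmod i o_gt0; have lt_j := ltn_pmod j o_gt0.
rewrite -(nth_uniq x _ _ (uniq_traject_porbit s x)) ?size_traject //.
by rewrite !nth_traject // !permX.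
Qed.

Lemma in_porbits s x C : C \in porbits s -> (x \in C) = (porbit s x == C).
Proof. by case/imsetP=> y _ ->; rewrite eq_porbit_mem. Qed.

Lemma sum_porbits s P (f : nat -> nat) : P \subset porbits s ->
  \sum_(x in cover P) f #|porbit s x| = \sum_(C in P) #|C| * f #|C|.
Proof.
move=> /subsetP sP.
rewrite (partition_big (porbit s) [in P]) /= => [|x /bigcupP[C PC]]; last first.
  by rewrite (in_porbits _ (sP _ PC)) => /eqP->.
apply: eq_bigr => C PC; rewrite (eq_bigr (fun=> f #|C|)); last first.
  by move=> x /andP[_ /eqP->].
rewrite sum_nat_const; congr (_ * _); apply: eq_card => x; rewrite unfold_in /=.
rewrite (in_porbits _ (sP _ PC)) andb_idl // => /eqP xC.
by apply/bigcupP; exists C => //; rewrite -xC porbit_id.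
Qed.

Lemma cover_porbits s : cover (porbits s) = [set: T].
Proof.
apply/setP=> x; rewrite inE; apply/bigcupP; exists (porbit s x).
  exact: imset_f.
exact: porbit_id.
Qed.

Lemma commute_permX s t F x i :
  (F * t = s * F)%g -> F ((s ^+ i)%g x) = (t ^+ i)%g (F x).
Proof.
move=> /permP FsP; elim: i => [|i IHi]; first by rewrite !expg0 !perm1.
by rewrite !expgSr !permM -IHi -permM -FsP permM.
Qed.

Lemma porbit_morph s t F x :
  (F * t = s * F)%g -> porbit t (F x) = F @: porbit s x.
Proof.
move=> FsP; apply/setP=> y;
  apply/porbitP/imsetP => [[i ->]|[z /porbitP[i ->] ->]].
  by exists ((s ^+ i)%g x); rewrite ?mem_porbit // (commute_permX _ _ FsP).
by exists i; rewrite (commute_permX _ _ FsP).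
Qed.

(* [r] selects a point in every cycle of [s] and [g] prescribes its image. *)
Lemma intertwiner_ext s t (r g : T -> T) :
    (forall x, r x \in porbit s x) ->
    (forall x y, y \in porbit s x -> r y = r x) ->
    (forall x, #|porbit t (g (r x))| = #|porbit s (r x)|) ->
    (forall x y, porbit t (g (r x)) = porbit t (g (r y)) -> r x = r y) ->
  exists F, (F * t = s * F)%g /\
    (forall x i, F ((s ^+ i)%g (r x)) = (t ^+ i)%g (g (r x))).
Proof.
move=> r_in r_const g_card g_inj.
have /fin_all_exists[k kP] x: exists i, x = (s ^+ i)%g (r x).
  by apply/porbitP; rewrite porbit_sym.
pose f x := (t ^+ k x)%g (g (r x)).
have fE x i : f ((s ^+ i)%g (r x)) = (t ^+ i)%g (g (r x)).
  set y := (s ^+ i)%g (r x).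
  have ry: r y = r x.
    by rewrite (r_const (r x)) ?mem_porbit // (r_const x).
  (* Under [s], both [k y] and [i] carry [r x] to [y], so they agree modulo the length of that
     cycle. The cycle of [t] through [g (r x)] has the same length, hence the choice of exponent
     does not affect [f]. *)
  apply/eqP; rewrite /f ry eq_permX_porbit g_card -eq_permX_porbit -{1}ry -kP.
  by [].
have f_inj: injective f.
  move=> x y fxy.
  have rxy: r x = r y.
    apply: g_inj; rewrite -[LHS](porbit_perm t (k x)).
    by rewrite -[RHS](porbit_perm t (k y)) -/(f x) fxy.
  move/eqP: fxy; rewrite /f rxy eq_permX_porbit g_card -eq_permX_porbit.
  by rewrite -{1}rxy -!kP => /eqP.
exists (perm f_inj); split=> [|x i]; last by rewrite permE fE.
apply/permP=> x; rewrite !permM !permE [in RHS](kP x) -permM -expgSr fE.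
by rewrite expgSr permM.
Qed.

(** This makes the centralizer of [s] transitive on the points lying in cycles of a given length.
    With [x] and [y] as preferred representatives, the transposition of [x] and [y] is prescribed on
    representatives and extended along the cycles. *)
Lemma centralizer_swap s x y : #|porbit s x| = #|porbit s y| ->
  exists F, [/\ (F * s = s * F)%g, F x = y &
    forall z, z \notin porbit s x -> z \notin porbit s y -> F z = z].
Proof.
move=> oxy.
pose c z := odflt z [pick u in porbit s z].
have c_in z : c z \in porbit s z.
  by rewrite /c; case: pickP => //= _; apply: porbit_id.
have c_const u z : z \in porbit s u -> c z = c u.
  rewrite -eq_porbit_mem /c => /eqP->; case: pickP => // /(_ u).
  by rewrite porbit_id.
pose r z := if z \in porbit s x then x else if z \in porbit s y then y else c z.
have r_in z : r z \in porbit s z.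
  rewrite /r; case: ifP; first by rewrite porbit_sym.
  by case: ifP; first by rewrite porbit_sym.
have r_const u z : z \in porbit s u -> r z = r u.
  move=> zu; rewrite /r -!eq_porbit_mem; move: (zu); rewrite -eq_porbit_mem.
  by move/eqP=> ->; rewrite (c_const _ _ zu).
have rx : r x = x by rewrite /r porbit_id.
have rr z : r (r z) = r z by apply: r_const.
have gr_card z : #|porbit s (tperm x y (r z))| = #|porbit s (r z)|.
  by case: tpermP => [->|->|].
have r_inj u v : porbit s u = porbit s v -> r u = r v.
  by move/eqP; rewrite eq_porbit_mem => /r_const.
have gr_inj z w : porbit s (tperm x y (r z)) = porbit s (tperm x y (r w)) ->
    r z = r w.
  (* If [x] and [y] share a cycle, the transposition sends each representative into its own cycle.
     Otherwise both points are representatives, and it permutes the representatives. *)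
  have [xy|nxy] := eqVneq (porbit s x) (porbit s y).
    have g_porbit u : porbit s (tperm x y (r u)) = porbit s u.
      transitivity (porbit s (r u)); first by case: tpermP => [->|->|].
      by apply/eqP; rewrite eq_porbit_mem.
    by rewrite !g_porbit => /r_inj.
  have ry : r y = y by rewrite /r -eq_porbit_mem eq_sym (negPf nxy) porbit_id.
  have g_rep u : r (tperm x y (r u)) = tperm x y (r u) by case: tpermP.
  by move=> /r_inj; rewrite !g_rep => /perm_inj.
have [F [FsP FE]] := intertwiner_ext r_in r_const gr_card gr_inj.
exists F; split=> //.
  by have := FE x 0; rewrite !expg0 !perm1 rx tpermL.
move=> z zx zy; have /porbitP[i zE] : z \in porbit s (r z).
  by rewrite porbit_sym.
rewrite {1}zE FE tpermD -?zE //.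
  by apply: contraNneq zx => ->; rewrite porbit_sym.
by apply: contraNneq zy => ->; rewrite porbit_sym.
Qed.

End CycleStructure.

(** * Cycle type, conjugacy and the order of centralizers *)

Lemma perm_eq_map_inj (I J K : eqType) (j0 : J) (f : I -> K) (g : J -> K)
    (a : seq I) (b : seq J) :
  uniq b -> perm_eq (map f a) (map g b) ->
  exists h : I -> J, [/\ {in a, forall i, h i \in b},
    {in a, forall i, g (h i) = f i} & {in a &, injective h}].
Proof.
case: a => [|i0 a'] Ub; first by exists (fun=> j0); split.
set a := i0 :: a'; move=> /(perm_iotaP (f i0))[Is IsP faE].
have szI : size Is = size a by rewrite -(size_map f) faE size_map.
have ltI i : i \in a -> nth 0 Is (index i a) < size b.
  move=> ia; rewrite -[_ < _](mem_iota 0) -(size_map g) -(perm_mem IsP).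
  by rewrite mem_nth // szI index_mem.
exists (fun i => nth j0 b (nth 0 Is (index i a))).
split=> [i ia|i ia|i j ia ja].
- by rewrite mem_nth ?ltI.
- rewrite -(nth_map j0 (f i0)) ?ltI // -(nth_map 0 (f i0)) ?szI ?index_mem //.
  by rewrite -faE (nth_map i0) ?index_mem // nth_index.
move/eqP; rewrite nth_uniq ?ltI // nth_uniq ?szI ?index_mem //; last first.
  by rewrite (perm_uniq IsP) iota_uniq.
by move/eqP/(congr1 (nth i0 a)); rewrite !nth_index.
Qed.

Section Conjugacy.

Variable T : finType.
Implicit Types (s t F : {perm T}) (x y : T) (C : {set T}) (P : {set {set T}}).

Lemma count_porbits s i :
  count_mem i [seq #|C| | C : {set T} <- enum (porbits s)] = spec s i.
Proof.
by rewrite /spec -sum1dep_card -sum1_count big_map big_enum_cond.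
Qed.

Lemma spec_out s i : ~~ (0 < i <= #|T|) -> spec s i = 0.
Proof.
move=> iP; apply: eq_card0 => C; rewrite !inE; apply: contraNF iP.
case/andP=> /imsetP[x _ ->] /eqP<-.
by rewrite lt0n card_porbit_neq0 max_card.
Qed.

Lemma spec_morph s t F : (F * t = s * F)%g -> spec s =1 spec t.
Proof.
move=> FsP i; rewrite /spec -(card_imset _ (imset_inj (@perm_inj _ F))).
apply: eq_card => C; rewrite !inE; apply/imsetP/andP.
  case=> D; rewrite inE => /andP[/imsetP[x _ ->] oD] ->.
  rewrite -(porbit_morph x FsP) imset_f // (porbit_morph x FsP).
  by rewrite (card_imset _ (@perm_inj _ F)).
case=> /imsetP[y _ ->] oy; exists (porbit s (F^-1 y)%g).
  rewrite inE imset_f //= -(card_imset _ (@perm_inj _ F)).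
  by rewrite -(porbit_morph _ FsP) permKV.
by rewrite -(porbit_morph _ FsP) permKV.
Qed.

Lemma spec_eq_conj s t :
  (forall i, 0 < i <= #|T| -> spec s i = spec t i) ->
  exists F, (F * t = s * F)%g.
Proof.
move=> st; have {}st i : spec s i = spec t i.
  by have [/st//|iP] := boolP (0 < i <= #|T|); rewrite !spec_out.
(* Equal cycle types yield an injective, length-preserving map [h] from the cycles of [s] to those
   of [t]. *)
have /(perm_eq_map_inj (set0 : {set T}) (enum_uniq _))[h [h_in h_card h_inj]] :
    perm_eq [seq #|C| | C : {set T} <- enum (porbits s)]
            [seq #|C| | C : {set T} <- enum (porbits t)].
  by apply/allP=> i _ /=; rewrite !count_porbits st.
have s_in x : porbit s x \in enum (porbits s) by rewrite mem_enum imset_f.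
(* The default [x] is returned only for empty [C], so on cycles [rep] is a choice of base point that
   does not depend on [x]. *)
pose rep C x := odflt x [pick u in C].
have rep_in s' x : rep (porbit s' x) x \in porbit s' x.
  by rewrite /rep; case: pickP => //= _; apply: porbit_id.
have rep_const s' C x y : C \in porbits s' -> rep C x = rep C y.
  case/imsetP=> z _ ->; rewrite /rep; case: pickP => // /(_ z).
  by rewrite porbit_id.
have h_porbits x : h (porbit s x) \in porbits t by rewrite -mem_enum h_in.
pose r x := rep (porbit s x) x.
pose g x := rep (h (porbit s x)) x.
have rE x : porbit s (r x) = porbit s x.
  by apply/eqP; rewrite eq_porbit_mem rep_in.
have gE x : porbit t (g x) = h (porbit s x).
  have /imsetP[z _ hz] := h_porbits x; rewrite hz; apply/eqP.
  by rewrite eq_porbit_mem /g hz (rep_const t _ x z) ?imset_f ?rep_in.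
have [||||F []] := @intertwiner_ext T s t r g; last by exists F.
- by move=> x; apply: rep_in.
- move=> x y; rewrite -eq_porbit_mem /r => /eqP->.
  by apply: (rep_const s); apply: imset_f.
- by move=> x; rewrite gE h_card.
move=> x y; rewrite !gE => /(h_inj _ _ (s_in _) (s_in _)); rewrite !rE => xy.
by rewrite /r xy; apply: (rep_const s); apply: imset_f.
Qed.

Lemma trivIset_porbits s P : P \subset porbits s -> trivIset P.
Proof.
move=> /subsetP sP; apply/trivIsetP=> C D /sP PC /sP PD nCD.
rewrite -setI_eq0; apply: contraR nCD => /set0Pn[x].
by rewrite inE (in_porbits _ PC) (in_porbits _ PD) => /andP[/eqP<- /eqP<-].
Qed.

(** Induction on [#|P|] by orbit-stabilizer at a point [x] of some [C] in [P]. The orbit is the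
    union of the cycles in [P] as long as [C], and the stabilizer is the same kind of group for
    [P :\ C]. *)
Lemma card_cent_Sym s P : P \subset porbits s ->
  #|('C[s] :&: Sym (cover P))%g| =
    \prod_(C in P) #|C| *
    \prod_(i < #|T|.+1) (#|[set C in P | #|C| == i]|)`!.
Proof.
have [m leP] := ubnP #|P|; elim: m => // m IHm in P leP * => sP.
have [->|[C PC]] := set_0Vmem P.
  rewrite big_set0 mul1n [in RHS]big1 => [|i _]; last first.
    rewrite (_ : [set _ in _ | _] = set0) ?cards0 //.
    by apply/setP=> C; rewrite !inE.
  rewrite /cover big_set0; apply/eqP/cards1P; exists 1%g.
  apply/setP=> F; rewrite in_setI in_set1 [F \in Sym _]inE.
  apply/andP/eqP => [[_ /subsetP F1]|->]; last first.
    by rewrite group1 perm_on1.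
  apply/permP=> x; rewrite perm1; apply/eqP/negPn/negP=> Fx.
  by have := F1 x Fx; rewrite inE.
set P' := P :\ C.
have sP' : P' \subset porbits s by apply: subset_trans sP; apply: subsetDl.
have ltP' : #|P'| < m by move: leP; rewrite (cardsD1 C) PC.
have PE : P = C |: P' by rewrite setD1K.
have /imsetP[x _ CE] := subsetP sP _ PC.
have xC : x \in C by rewrite CE porbit_id.
have tiP := trivIset_porbits sP.
have coverE : cover P = C :|: cover P'.
  by rewrite PE /cover bigcup_setU big_set1.
have disjC y : y \in C -> y \notin cover P'.
  move=> yC; apply/bigcupP=> -[D]; rewrite !inE => /andP[DC PD].
  rewrite (in_porbits _ (subsetP sP _ PD)).
  move: yC; rewrite (in_porbits _ (subsetP sP _ PC)) => /eqP->.
  by rewrite eq_sym (negPf DC).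
pose G := ('C[s] :&: Sym (cover P))%G.
have GP F : reflect (F * s = s * F /\ perm_on (cover P) F)%g (F \in G).
  rewrite in_setI [F \in Sym _]inE.
  by apply: (iffP andP) => -[FsP onF]; split=> //; apply/cent1P.
have orbE : orbit 'P G x = cover [set D in P | #|D| == #|C|].
  apply/setP=> y; apply/orbitP/bigcupP => [[F /GP[FsP onF] <-]|[D]].
    exists (porbit s (F x)); rewrite ?porbit_id //.
    have : F x \in cover P by rewrite perm_closed // coverE inE xC.
    case/bigcupP=> D PD; rewrite (in_porbits _ (subsetP sP _ PD)) => /eqP DE.
    rewrite inE {1}DE PD (porbit_morph x FsP).
    by rewrite (card_imset _ (@perm_inj _ F)) CE /=.
  rewrite inE => /andP[PD oD] yD.
  move: (yD); rewrite (in_porbits _ (subsetP sP _ PD)) => /eqP DE.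
  have [|F [FsP Fx Fid]] := @centralizer_swap T s x y.
    by rewrite -CE DE (eqP oD).
  exists F => //; apply/GP; split=> //; apply/subsetP=> z.
  apply: contraR => zP; apply/eqP/Fid.
    by apply: contraNN zP; rewrite -CE => zC; apply/bigcupP; exists C.
  by apply: contraNN zP; rewrite DE => zC; apply/bigcupP; exists D.
(* An element that commutes with [s] and fixes [x] fixes the whole cycle [C] of [x]. *)
have stabE : ('C_G[x | 'P] = 'C[s] :&: Sym (cover P'))%g.
  apply/setP=> F; rewrite in_setI /= in_setI -andbA.
  rewrite [F \in Sym _]inE [F \in _ :&: Sym _]in_setI [F \in Sym _]inE.
  rewrite (sameP astab1P eqP) /= apermE.
  apply/and3P/andP => [[Fs onF /eqP Fx]|[Fs onF]].
    split=> //; apply/subsetP=> y yF; have := subsetP onF y yF.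
    rewrite coverE inE => /orP[|//]; rewrite CE => /porbitP[i yE].
    case/eqP: yF; rewrite yE (@commute_permX _ s s) ?Fx //.
    by apply/cent1P.
  split=> //; first by apply: subset_trans onF _; rewrite coverE subsetUr.
  by apply/eqP; apply: (out_perm onF); apply: disjC.
have := card_orbit_stab 'P G x; rewrite stabE (IHm P') // => <-.
have -> : #|orbit 'P G x| = #|C| * #|[set D in P | #|D| == #|C|]|.
  rewrite orbE -sum1_card.
  rewrite (@sum_porbits _ s _ (fun=> 1)); last first.
    by apply: subset_trans sP; apply/subsetP=> D; rewrite inE => /andP[].
  rewrite (eq_bigr (fun=> #|C|)) => [|D]; first by rewrite sum_nat_const mulnC.
  by rewrite inE muln1 => /andP[_ /eqP].
rewrite [in RHS](big_setD1 C) //= -/P' -[LHS]mulnA -[RHS]mulnA.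
congr (_ * _); rewrite mulnCA; congr (_ * _).
have ltC : #|C| < #|T|.+1 by rewrite ltnS max_card.
rewrite (bigD1 (Ordinal ltC)) //= [in RHS](bigD1 (Ordinal ltC)) //= mulnA.
congr (_ * _).
  (* [P'] has one cycle of length [#|C|] fewer, so the orbit factor completes the factorial for that
     length. *)
  rewrite (cardsD1 C) inE PC eqxx add1n factS; congr (_ * _`!).
  by apply: eq_card => D; rewrite !inE andbA.
apply: eq_bigr => i iC; congr (_`!); apply: eq_card => D; rewrite !inE.
have [->|//] := eqVneq D C; rewrite PC /=.
by apply/esym/negbTE; apply: contraNneq iC => Ci; apply/eqP/val_inj.
Qed.

Lemma big_porbits_spec (R : Type) (idx : R) (op : Monoid.com_law idx)
    s (f : nat -> R) :
  \big[op/idx]_(C in porbits s) f #|C| =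
    \big[op/idx]_(i < #|T|) \big[op/idx]_(j < spec s i.+1) f i.+1.
Proof.
have CP C : C \in porbits s -> 0 < #|C| <= #|T|.
  by case/imsetP=> x _ ->; rewrite lt0n card_porbit_neq0 max_card.
(* No cycle has length 0, so that index contributes nothing; after it is split off, index [i] stands
   for length [i.+1]. *)
rewrite (partition_big (fun C => inord #|C| : 'I_#|T|.+1) xpredT) //=.
rewrite big_ord_recl /= big1 => [|C]; last first.
  case/andP=> /CP/andP[C_gt0 C_le] /eqP/(congr1 val).
  by rewrite /= inordK ?ltnS //; case: #|C| C_gt0.
rewrite Monoid.mul1m; apply: eq_bigr => i _.
rewrite (eq_bigr (fun=> f i.+1)) => [|C]; last first.
  case/andP=> /CP/andP[C_gt0 C_le] /eqP/(congr1 val).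
  by rewrite /= inordK ?ltnS // => ->.
rewrite big_const big_const_ord; congr iter; apply: eq_card => C.
rewrite unfold_in !inE.
have [/CP/andP[C_gt0 C_le]|//] := boolP (C \in porbits s).
by rewrite -val_eqE /= inordK ?ltnS.
Qed.

(** The previous count with all cycles in [P]. The bound [m] is a variable so that the product can
    run up to [n] or [2 ^ n] instead of the cardinal of a type. *)
Lemma card_cent1_perm s m : m = #|T| ->
  #|'C[s]%g| = \prod_(i < m) (i.+1 ^ spec s i.+1 * (spec s i.+1)`!).
Proof.
move=> ->; have := card_cent_Sym (subxx (porbits s)).
rewrite cover_porbits (_ : ('C[s] :&: Sym [set: T])%g = 'C[s]%g); last first.
  by apply/setIidPl/subsetP=> F _; rewrite inE; apply/subsetP=> x; rewrite inE.
move=> ->; rewrite big_ord_recl /=.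
rewrite (_ : #|[set C in _ | _]| = 0) ?mul1n; last first.
  exact: (@spec_out s 0).
rewrite big_split (big_porbits_spec _ s id) /=; congr (_ * _).
by apply: eq_bigr => i _; rewrite prod_nat_const card_ord.
Qed.

End Conjugacy.

(** * Existence of permutations with a prescribed cycle type *)

Lemma uniq_flatten_inj (T : eqType) (ss : seq (seq T)) x (c d : seq T) :
  uniq (flatten ss) -> c \in ss -> d \in ss -> x \in c -> x \in d -> c = d.
Proof.
elim: ss => //= b ss IHss; rewrite cat_uniq => /and3P[_ /hasPn disj Uss].
have notin e : e \in ss -> x \in e -> x \notin b.
  by move=> es xe; apply: disj; apply/flattenP; exists e.
rewrite !inE => /orP[/eqP->|cs] /orP[/eqP->|ds] // xc xd.
- by have := notin _ ds xd; rewrite xc.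
- by have := notin _ cs xc; rewrite xd.
exact: IHss.
Qed.

Lemma uniq_flatten_uniq (T : eqType) (ss : seq (seq T)) :
  [::] \notin ss -> uniq (flatten ss) -> uniq ss.
Proof.
elim: ss => //= -[|x c] ss IHss; rewrite inE //= => ns.
rewrite cat_uniq mem_cat negb_or => /and3P[/andP[_ xss] _ /andP[_ Uss]].
rewrite IHss // andbT; apply: contraNN xss => cs.
by apply/flattenP; exists (x :: c); rewrite ?mem_head.
Qed.

Section FromShape.

Variable T : finType.

Lemma porbit_fconnect (s : {perm T}) x : porbit s x =i fconnect s x.
Proof.
move=> y; apply/porbitP/idP => [[i ->]|xy].
  by rewrite permX; apply: fconnect_iter.
by exists (findex s x y); rewrite permX iter_findex.
Qed.

(** The enumeration of [T] is cut into blocks whose lengths are the entries of [l], and each point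
    is sent to the cyclically next one in its block. As [l] has no entry 0, the blocks are nonempty
    and are exactly the cycles. *)
Lemma spec_surj (l : seq nat) :
  sumn l = #|T| -> 0 \notin l ->
  exists s : {perm T}, forall i, spec s i = count_mem i l.
Proof.
move=> lT l0; pose ss := reshape l (enum T).
have ss_enum : flatten ss = enum T by rewrite reshapeKr // lT cardE.
have ss_l : shape ss = l by rewrite reshapeKl // lT cardE.
have Uf : uniq (flatten ss) by rewrite ss_enum enum_uniq.
have nil_ss : [::] \notin ss.
  by apply: contraNN l0 => nil_ss; rewrite -ss_l; apply: (map_f size nil_ss).
have Uss := uniq_flatten_uniq nil_ss Uf.
pose b x := nth [::] ss (find (fun c => x \in c) ss).
have b_has x : has (fun c => x \in c) ss.
  have : x \in flatten ss by rewrite ss_enum mem_enum.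
  by case/flattenP=> c cs xc; apply/hasP; exists c.
have x_b x : x \in b x by apply: (nth_find [::] (b_has x)).
have b_ss x : b x \in ss by rewrite mem_nth // -has_find.
have bP c x : c \in ss -> x \in c -> b x = c.
  by move=> cs xc; apply: (uniq_flatten_inj Uf _ cs (x_b x)).
have Uc c : c \in ss -> uniq c.
  move=> cs; move: Uf; case/splitPr: cs => s1 s2.
  by rewrite flatten_cat cat_uniq /= cat_uniq => /and4P[].
pose f x := next (b x) x.
have bf x : b (f x) = b x by apply: bP; rewrite ?mem_next.
have f_inj : injective f.
  move=> x y fxy; have bxy : b x = b y by rewrite -(bf x) fxy bf.
  by rewrite -(prev_next (Uc _ (b_ss x)) x) -/(f x) fxy /f bxy prev_next ?Uc.
exists (perm f_inj) => i.
have orbE x : porbit (perm f_inj) x = [set y in b x].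
  apply/setP=> y; rewrite porbit_fconnect inE; apply: fconnect_cycle => //.
  have : fcycle (next (b x)) (b x) by apply/cycle_next/Uc.
  apply: (sub_in_cycle (P := [in b x])); last by apply/allP.
  by move=> u v ub _ /eqP<-; rewrite /= permE /f (bP (b x)).
rewrite -count_porbits.
have /seq.permP-> :
  perm_eq [seq #|C| | C : {set T} <- enum (porbits (perm f_inj))]
    [seq #|C| | C : {set T} <- [seq [set y in c] | c : seq T <- ss]].
  apply/perm_map/uniq_perm; rewrite ?enum_uniq //.
    rewrite map_inj_in_uniq // => -[|x c] d cs ds.
      by rewrite (negPf nil_ss) in cs.
    move=> /setP/(_ x); rewrite !inE eqxx => /esym xd.
    by apply: (uniq_flatten_inj Uf cs ds _ xd); rewrite mem_head.
  move=> C; rewrite mem_enum; apply/imsetP/mapP => [[x _ ->]|[[|x c] cs ->]].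
  - by exists (b x); rewrite ?orbE.
  - by rewrite (negPf nil_ss) in cs.
  by exists x; rewrite // orbE (bP (x :: c)) ?mem_head.
rewrite -map_comp -[in RHS]ss_l; congr (count _ _).
apply/eq_in_map=> c cs /=.
by rewrite cardsE; apply/card_uniqP/Uc.
Qed.

Lemma sum_spec (s : {perm T}) m :
  m = #|T| -> \sum_(i < m) i.+1 * spec s i.+1 = m.
Proof.
move=> mT; have := sum_porbits (fun=> 1) (subxx (porbits s)).
rewrite cover_porbits sum1_card cardsT -mT => mE; rewrite [RHS]mE {mE}.
rewrite [RHS](eq_bigr (fun C : {set T} => #|C|)); last first.
  by move=> C _; rewrite muln1.
rewrite (big_porbits_spec _ s id) -mT; apply: eq_bigr => i _.
by rewrite sum_nat_const card_ord mulnC.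
Qed.

End FromShape.

Lemma partition_spec n (p : {ffun 'I_n -> 'I_n.+1}) :
  p \in partitions n -> exists s : 'S_n, forall i : 'I_n, spec s i.+1 = p i.
Proof.
rewrite inE => /eqP pn.
pose l := flatten [seq nseq (p i) i.+1 | i <- enum 'I_n].
have [||s sP] := @spec_surj 'I_n l.
- rewrite sumn_flatten -map_comp sumnE big_map big_enum card_ord -[RHS]pn.
  by apply: eq_bigr => i _; rewrite /= sumn_nseq.
- by apply/flattenP=> -[_ /mapP[i _ ->]]; rewrite mem_nseq andbF.
exists s => i; rewrite sP count_flatten -map_comp sumnE big_map big_enum /=.
rewrite (bigD1 i) //= count_nseq /= eqxx mul1n big1 ?addn0 // => j ji.
by rewrite count_nseq /= eqSS val_eqE (negPf ji).
Qed.

(** * Cycle counts of all powers determine the cycle type *)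

Section Powers.

Variable T : finType.
Implicit Types (s t F : {perm T}) (x y : T) (C : {set T}).

Lemma card_porbitX s k x :
  #|porbit (s ^+ k) x| * gcdn #|porbit s x| k = #|porbit s x|.
Proof.
set o' := #|porbit (s ^+ k) x|; set o := #|porbit s x|.
have o_gt0 : 0 < o by rewrite lt0n card_porbit_neq0.
(* Both numbers have the same multiples [m], namely those for which the cycle length [o] divides
   [k * m]; hence they are equal. *)
have dvdE m : (o' %| m) = (o %/ gcdn o k %| m).
  transitivity (o %| k * m).
    have := eq_permX_porbit (s ^+ k) x m 0; rewrite mod0n /dvdn => <-.
    by rewrite -expgM expg0 -[1%g](expg0 s) eq_permX_porbit mod0n.
  rewrite -[in RHS](@dvdn_pmul2l (gcdn o k)) ?gcdn_gt0 ?o_gt0 //.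
  rewrite [_ * (o %/ _)]mulnC divnK ?dvdn_gcdl // muln_gcdl.
  by rewrite dvdn_gcd [o %| o * m]dvdn_mulr.
have -> : o' = o %/ gcdn o k.
  by apply/eqP; rewrite eqn_dvd dvdE dvdnn -dvdE dvdnn.
by rewrite divnK ?dvdn_gcdl.
Qed.

(* Clearing denominators in [#|porbits s| = \sum_x 1 / #|porbit s x|]. *)
Lemma card_porbits_sum s :
  #|T|`! * #|porbits s| = \sum_x #|T|`! %/ #|porbit s x|.
Proof.
rewrite (eq_bigl [in cover (porbits s)]); last first.
  by move=> x; rewrite cover_porbits inE.
rewrite (sum_porbits (fun o => #|T|`! %/ o) (subxx _)) mulnC -sum_nat_const.
apply: eq_bigr => C /imsetP[x _ ->]; rewrite mulnC divnK //.
by rewrite dvdn_fact // lt0n card_porbit_neq0 max_card.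
Qed.

(** A cycle of length [m] splits into [gcdn m k] cycles of the [k]-th power. After multiplication by
    the factorial of [#|T|], the contributions of single points are compared and grouped by cycles
    of [s]. *)
Lemma card_porbitsX s k :
  #|porbits (s ^+ k)| = \sum_(C in porbits s) gcdn #|C| k.
Proof.
apply/eqP; rewrite -(eqn_pmul2l (fact_gt0 #|T|)) card_porbits_sum; apply/eqP.
pose f o := gcdn o k * (#|T|`! %/ o).
transitivity (\sum_(x in cover (porbits s)) f #|porbit s x|).
  apply: eq_big => [x|x _]; rewrite ?cover_porbits ?inE // /f.
  have oP y t : 0 < #|porbit t y| by rewrite lt0n card_porbit_neq0.
  have /dvdnP[q ->] : #|porbit s x| %| #|T|`!.
    by rewrite dvdn_fact // oP max_card.
  rewrite mulnK ?oP // -{1}(card_porbitX s k x) mulnCA mulKn ?oP //.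
  by rewrite mulnC.
rewrite (sum_porbits f (subxx _)) big_distrr /=.
apply: eq_bigr => C /imsetP[x _ ->]; rewrite /f mulnCA [in LHS]mulnC.
congr (_ * _); rewrite mulnC divnK // dvdn_fact //.
by rewrite lt0n card_porbit_neq0 max_card.
Qed.

(** Gauss's identity at [gcdn m k]. The index range depends on [k] alone and [m] enters only through
    an indicator, so the sum can be exchanged with one over cycles. *)
Lemma gcdn_sum_totient m k : 0 < k ->
  gcdn m k = \sum_(d < k.+1 | d %| k) totient d * (d %| m).
Proof.
move=> k_gt0; rewrite -[LHS]sum_totient_dvd.
have leg : gcdn m k < k.+1 by rewrite ltnS dvdn_leq ?dvdn_gcdr.
rewrite (big_ord_widen_cond _ (fun d => d %| gcdn m k) totient leg).
rewrite [RHS](bigID (fun d : 'I__ => d %| m)) /= [RHS]addnC.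
rewrite [X in _ = X + _]big1 ?add0n; last first.
  by move=> d /andP[_ /negPf->]; rewrite muln0.
apply: eq_big => [d|d /andP[]]; last first.
  by rewrite dvdn_gcd => /andP[->]; rewrite muln1.
rewrite dvdn_gcd andbC; have [dk|] := boolP (d %| k); rewrite ?andbF // andbT.
rewrite andb_idl // => dm.
rewrite ltnS dvdn_leq //; last by rewrite dvdn_gcd dm.
by rewrite gcdn_gt0 k_gt0 orbT.
Qed.

(** [A u d] counts the cycles of [u] of length divisible by [d]. Two triangular systems are solved:
    cycle counts of powers determine [A] by ascending induction, and [A] determines [spec] by
    descending induction. *)
Lemma spec_eq_of_card_porbitsX s t :
  (forall k, #|porbits (s ^+ k)| = #|porbits (t ^+ k)|) -> spec s =1 spec t.
Proof.
move=> st; pose A (u : {perm T}) d := \sum_(C in porbits u) (d %| #|C|).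
(* The divisor [k] itself is [ord_max]; its coefficient [totient k] is positive and can be
   cancelled. *)
have cycE u k : 0 < k -> #|porbits (u ^+ k)| = totient k * A u k +
    \sum_(d < k.+1 | (d %| k) && (d != ord_max)) totient d * A u d.
  move=> k_gt0; rewrite card_porbitsX.
  rewrite (eq_bigr _ (fun C _ => gcdn_sum_totient #|C| k_gt0)) exchange_big.
  rewrite (bigD1 ord_max) //= -big_distrr; congr (_ + _).
  by apply: eq_bigr => d _; rewrite -big_distrr.
have AE k : 0 < k -> A s k = A t k.
  have [m] := ubnP k; elim: m k => // m IHm k le_km k_gt0.
  have := st k; rewrite !cycE //.
  rewrite (eq_bigr (fun d : 'I_k.+1 => totient d * A t d)) => [/addIn/eqP|d].
    by rewrite eqn_pmul2l ?totient_gt0 // => /eqP.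
  case/andP=> dk nd; rewrite IHm ?(dvdn_gt0 _ dk) //.
  apply: leq_trans (ltnSE le_km).
  by rewrite ltn_neqAle nd -ltnS ltn_ord.
have A_spec u k (kT : k < #|T|) : A u k.+1 = spec u k.+1 +
    \sum_(i < #|T| | (k.+1 %| i.+1) && (i != Ordinal kT)) spec u i.+1.
  rewrite /A (big_porbits_spec _ u (fun m => k.+1 %| m : nat)).
  rewrite -(bigD1 (Ordinal kT)) //= [RHS]big_mkcond.
  apply: eq_bigr => i _; rewrite sum_nat_const card_ord.
  by case: (k.+1 %| _); rewrite ?muln0 ?muln1.
(* Here [m] bounds [#|T| - k], so induction on [m] starts from the longest cycles; proper multiples
   of [k.+1] are already settled. *)
suff spE m k : #|T| <= k + m -> spec s k.+1 = spec t k.+1.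
  by case=> [|k]; [rewrite !spec_out | apply: (spE #|T|); rewrite leq_addl].
elim: m k => [|m IHm] k lekm.
  by rewrite !spec_out // -ltnNge ltnS -[k]addn0.
have [kT|Tk] := ltnP k #|T|; last by rewrite !spec_out // -ltnNge.
have := AE k.+1 isT; rewrite !(A_spec _ _ kT).
rewrite (eq_bigr (fun i : 'I_#|T| => spec t i.+1)) => [/addIn//|i /andP[ki ik]].
apply: IHm; rewrite -addSnnS in lekm; apply: leq_trans lekm _.
by rewrite leq_add2r ltn_neqAle eq_sym ik -ltnS dvdn_leq.
Qed.

End Powers.

(** * Coordinate permutations of the cube and their fixed points *)

Section CoordPerm.

Variable n : nat.
Implicit Types s t : 'S_n.

(** Permuting coordinates is precomposition, which reverses products. *)
Lemma coord_permM s t : coord_perm (s * t)%g = (coord_perm t * coord_perm s)%g.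
Proof.
apply/permP=> x; rewrite permM !permE.
by apply/ffunP=> i; rewrite !ffunE permM.
Qed.

Lemma coord_perm1 : coord_perm (1 : 'S_n)%g = 1%g.
Proof.
by apply/permP=> x; rewrite !permE; apply/ffunP=> i; rewrite !ffunE perm1.
Qed.

Lemma coord_permX s k : coord_perm (s ^+ k)%g = (coord_perm s ^+ k)%g.
Proof.
by elim: k => [|k IHk]; rewrite ?coord_perm1 // expgS coord_permM IHk expgSr.
Qed.

Lemma coord_permV s : coord_perm (s^-1)%g = ((coord_perm s)^-1)%g.
Proof.
by apply/eqP; rewrite eq_sym eq_invg_mul -coord_permM mulVg coord_perm1.
Qed.

(** A point of the cube is fixed exactly when it is constant on the cycles of [s], so it amounts to
    the set of cycles on which it is true. *)
Lemma card_fix_coord_perm s :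
  #|[set x | coord_perm s x == x]| = 2 ^ #|porbits s|.
Proof.
rewrite -card_powerset.
pose f (D : {set {set 'I_n}}) : cube n := [ffun i => porbit s i \in D].
rewrite -(card_in_imset (f := f)); last first.
  move=> D E; rewrite !inE => /subsetP sD /subsetP sE /ffunP fDE.
  apply/setP=> C; apply/idP/idP=> CD.
    by have /imsetP[i _ Ci] := sD _ CD; have := fDE i; rewrite !ffunE -Ci CD.
  by have /imsetP[i _ Ci] := sE _ CD; have := fDE i; rewrite !ffunE -Ci CD.
apply: eq_card => x; rewrite inE permE.
apply/eqP/imsetP => [xs|[D _ ->]]; last first.
  by apply/ffunP=> i; have := porbit_perm s 1 i; rewrite !ffunE expg1 => ->.
have xsX i k : x ((s ^+ k)%g i) = x i.
  elim: k => [|k IHk]; first by rewrite perm1.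
  by rewrite -IHk expgSr permM -{2}xs ffunE.
exists (porbit s @: [set i | x i]).
  by rewrite inE; apply: imsetS; apply/subsetP.
apply/ffunP=> i; rewrite ffunE; apply/idP/imsetP => [xi|[j]].
  by exists i; rewrite ?inE.
rewrite inE => xj /eqP; rewrite eq_porbit_mem => /porbitP[k ->].
by rewrite xsX.
Qed.

(** [F] maps the fixed points of each power of [coord_perm s] onto those of the same power of
    [coord_perm t], so the powers of [s] and [t] have equally many cycles. *)
Lemma spec_coord_perm_inj s t (F : {perm cube n}) :
  (F * coord_perm t = coord_perm s * F)%g -> spec s =1 spec t.
Proof.
move=> FsP; apply: spec_eq_of_card_porbitsX => k.
apply: (@expnI 2) => //; rewrite -!card_fix_coord_perm !coord_permX.
rewrite -(card_imset _ (@perm_inj _ F)); apply: eq_card => y.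
rewrite inE; apply/imsetP/eqP => [[x]|yE].
  by rewrite inE => /eqP xE ->; rewrite -(commute_permX x k FsP) xE.
exists ((F^-1)%g y); last by rewrite permKV.
rewrite inE; apply/eqP/(@perm_inj _ F).
by rewrite (commute_permX _ _ FsP) permKV.
Qed.

End CoordPerm.

(** * Burnside counting and grouping by cycle type *)

Section Counting.

Variable n : nat.
Implicit Types (s t : 'S_n) (F H : {perm cube n}) (a : 'S_n * 'S_n).

(** Since [coord_perm] reverses products, inverting the first component gives a right action. Its
    orbits are the equivalence classes because the inverse also runs over all of ['S_n]. *)
Definition coord_act F a : {perm cube n} :=
  (coord_perm a.2 * F * coord_perm (a.1^-1))%g.

Lemma coord_act1 : coord_act^~ 1%g =1 id.
Proof. by move=> F; rewrite /coord_act /= invg1 coord_perm1 mulg1 mul1g. Qed.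

Lemma coord_actM F : act_morph coord_act F.
Proof. by move=> a b; rewrite /coord_act /= invMg !coord_permM !mulgA. Qed.

Canonical coord_action := TotalAction coord_act1 coord_actM.

Lemma equivalent_orbit F H :
  equivalent F H = (H \in orbit coord_action [set: 'S_n * 'S_n] F).
Proof.
apply/existsP/orbitP => [[rho /existsP[sigma /forallP HE]]|[[rho sigma] _ <-]].
  exists (rho^-1, sigma)%g; first by rewrite inE.
  by apply/permP=> x; rewrite /= /coord_act /= invgK !permM (eqP (HE x)).
exists (rho^-1)%g; apply/existsP; exists sigma; apply/forallP=> x.
by rewrite /= /coord_act /= !permM.
Qed.

Lemma nclasses_orbits :
  nclasses n = #|orbit coord_action [set: 'S_n * 'S_n] @: [set: {perm cube n}]|.
Proof.
congr #|pred_of_set _|; apply: eq_imset => F; apply/setP=> H.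
by rewrite inE equivalent_orbit in_setT.
Qed.

(** Truncation by [inord] is harmless, as there are at most [n] cycles of any length. *)
Definition ptype s : {ffun 'I_n -> 'I_n.+1} :=
  [ffun i : 'I_n => inord (spec s i.+1)].

Lemma ptypeE s (i : 'I_n) : ptype s i = spec s i.+1 :> nat.
Proof.
rewrite ffunE inordK // ltnS -[leqRHS](sum_spec s (esym (card_ord n))).
by rewrite (bigD1 i) //= mulSn -addnA leq_addr.
Qed.

Lemma ptype_partition s : ptype s \in partitions n.
Proof.
rewrite inE -[X in _ == X](sum_spec s (esym (card_ord n))).
by apply/eqP/eq_bigr => i _; rewrite ptypeE.
Qed.

Lemma ptype_conj s t : ptype s = ptype t <-> exists u, (u * t = s * u)%g.
Proof.
split=> [st|[u us]]; last first.
  by apply/ffunP=> i; apply/val_inj; rewrite /= !ptypeE (spec_morph us).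
apply: spec_eq_conj; rewrite card_ord => -[//|i] /= lt_i.
by rewrite -(ptypeE s (Ordinal lt_i)) st ptypeE.
Qed.

Lemma card_intertwiners s t :
  #|[set F | F * coord_perm t == coord_perm s * F]%g| =
    (ptype s == ptype t) * #|'C[coord_perm s]%g|.
Proof.
have [/ptype_conj[u us]|nst] := eqVneq; last first.
  apply: eq_card0 => F; rewrite inE; apply: contraNF nst => /eqP FsP.
  apply/eqP/ffunP=> i; apply/val_inj.
  by rewrite /= !ptypeE (spec_coord_perm_inj FsP).
have {us} [F0 F0P] : exists F0, (F0 * coord_perm t = coord_perm s * F0)%g.
  (* The inverse appears because [coord_perm] reverses the relation [u * t = s * u]. *)
  exists (coord_perm u^-1)%g; apply: (mulgI (coord_perm u)).
  apply: (mulIg (coord_perm u)).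
  rewrite coord_permV !mulgA mulgV mul1g -!mulgA mulVg mulg1.
  by rewrite -!coord_permM us.
have F0V : (F0^-1 * coord_perm s = coord_perm t * F0^-1)%g.
  by apply: (mulgI F0); apply: (mulIg F0); rewrite mulKVg -F0P mulgA mulgKV.
rewrite mul1n -(card_rcoset _ F0); apply: eq_card => F.
rewrite inE mem_rcoset; apply/eqP/cent1P => [FsP|].
  by rewrite /commute mulgA -FsP -!mulgA F0V.
rewrite /commute => /(congr1 (mulg^~ F0)).
by rewrite -!mulgA mulVg mulg1 -F0P !mulgA mulgKV.
Qed.

(** The permutations of the type of [s] form its conjugacy class, whose size is the index of the
    centralizer. *)
Lemma card_ptype s :
  #|[set t | ptype t == ptype s]| *
    \prod_(i < n) (i.+1 ^ spec s i.+1 * (spec s i.+1)`!) = n`!.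
Proof.
rewrite -(card_cent1_perm s (esym (card_ord n))) -[in RHS](card_Sn n) -cardsT.
rewrite -(Lagrange (subsetT 'C[s]%G)) mulnC; congr (_ * _).
have := index_cent1 [set: 'S_n]%G s; rewrite setTI => ->; apply: eq_card => t.
rewrite inE; apply/eqP/imsetP => [/ptype_conj[u us]|[u _ ->]].
  by exists (u^-1)%g; rewrite ?inE // conjgE invgK mulgA us mulgK.
apply/ptype_conj; exists (u^-1)%g.
by rewrite conjgE -!mulgA mulgV mulg1.
Qed.

Lemma nclasses_sum :
  nclasses n * (n`! * n`!) =
    \sum_(p in partitions n) \sum_(s | ptype s == p)
      #|[set t | ptype t == p]| * #|'C[coord_perm s]%g|.
Proof.
have -> : n`! * n`! = #|[set: 'S_n * 'S_n]|.
  by rewrite cardsT card_prod -!(card_Sn n).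
rewrite nclasses_orbits -Frobenius_Cauchy; last first.
  by apply/actsP=> a _ F; rewrite !inE.
rewrite (eq_bigl xpredT) => [|a]; last by rewrite inE.
(* Here [s] is [rho] and [t] is [sigma]; the pair fixes [F] exactly when [F] intertwines
   [coord_perm sigma] and [coord_perm rho]. *)
transitivity (\sum_s \sum_t (ptype t == ptype s) * #|'C[coord_perm t]%g|).
  rewrite pair_bigA; apply: eq_bigr => -[rho sigma] _ /=.
  rewrite -card_intertwiners; apply: eq_card => F.
  rewrite setTI [RHS]inE (sameP afix1P eqP) /= /coord_act coord_permV /=.
  apply/eqP/eqP => [FE|<-]; last by rewrite mulgK.
  by rewrite -{1}FE mulgKV.
(* With [sigma] outermost, the centralizer no longer depends on the inner index, which just counts
   the [rho] of the same type. *)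
rewrite exchange_big (partition_big ptype [in partitions n]) /=; last first.
  by move=> s _; apply: ptype_partition.
apply: eq_bigr => p _; apply: eq_bigr => s /eqP sp.
rewrite -big_distrl; congr (_ * _).
rewrite -sum1dep_card [RHS]big_mkcond sp; apply: eq_bigr => t _.
by rewrite eq_sym; case: (_ == _).
Qed.

End Counting.

(** * The formula over the rationals *)

Import GRing.Theory.
Local Open Scope ring_scope.

(** The first part ensures that choices [c] of representatives exist; the second proves the formula
    for every such choice. *)
Theorem theorem1 (n : nat) (hn : (1 <= n)%N) :
  (forall p : {ffun 'I_n -> 'I_n.+1}, p \in partitions n ->
     exists s : 'S_n, forall i : 'I_n, spec s i.+1 = p i) /\
  (forall c : {ffun 'I_n -> 'I_n.+1} -> 'S_n,
     (forall p : {ffun 'I_n -> 'I_n.+1}, p \in partitions n ->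
        forall i : 'I_n, spec (c p) i.+1 = p i) ->
     (nclasses n)%:R =
       \sum_(p in partitions n)
         (\prod_(i < 2 ^ n)
            (i.+1 ^ spec (coord_perm (c p)) i.+1 *
             (spec (coord_perm (c p)) i.+1)`!))%N%:R
         / ((\prod_(i < n) (i.+1 ^ p i * (p i)`!)) ^ 2)%N%:R :> rat).
Proof.
split=> [p|c cP]; first exact: partition_spec.
have nz_fact : (n`!)%:R != 0 :> rat.
  by rewrite Num.Theory.pnatr_eq0 -lt0n fact_gt0.
(* Multiplying twice by n! reduces the claim to the Burnside count, term by term in [p]. *)
apply: (mulIf nz_fact); apply: (mulIf nz_fact).
rewrite -mulrA -!natrM nclasses_sum natr_sum !big_distrl /=.
apply: eq_bigr => p pn.
have cpE : ptype (c p) = p.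
  by apply/ffunP=> i; apply/val_inj; rewrite /= ptypeE cP.
have cardK := card_ptype (c p).
rewrite cpE in cardK.
rewrite (eq_bigr (fun i : 'I_n => i.+1 ^ p i * (p i)`!)%N) in cardK; last first.
  by move=> i _; rewrite cP.
rewrite -(card_cent1_perm (coord_perm (c p)) (m := 2 ^ n)); last first.
  by rewrite card_ffun card_bool card_ord.
(* All [s] of type [p] are conjugate to [c p], so the centralizers of their coordinate permutations
   have the same order. *)
rewrite (eq_bigr (fun=>
  #|[set t | ptype t == p]| * #|'C[coord_perm (c p)]%g|)%N); last first.
  move=> s /eqP sp; congr (_ * _)%N.
  have /ptype_conj[u us] : ptype s = ptype (c p) by rewrite sp cpE.
  rewrite -(cardJg _ (coord_perm u)%g) -cent1J.
  congr #|'C[_]%g|.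
  by rewrite conjgE -coord_permV -!coord_permM us mulgK.
rewrite sum_nat_cond_const.
(* [K] permutations have type [p] and [K * z] is n!, so dividing [K ^ 2] by (n!)^2 leaves the factor
   [z ^ 2] in the denominator. *)
move: cardK; set K := #|[set t | _]|; set z := (\prod_(i < n) _)%N => Kz.
have z_nz : z%:R != 0 :> rat.
  by move: nz_fact; rewrite -Kz natrM mulf_eq0 negb_or => /andP[].
by rewrite -Kz natrX !natrM; field.
Qed.
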